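(* Let $k$ be an algebraically closed field with $\mathrm{char}\,k=0$, and let $m\geqslant 3$ and $n\geqslant 1$ be integers. Then for every representation type $\tau$, the set $Q_{m,n}(\tau)$ of all points of $\mathrm{Mat}_n(k)^m/\!\!/\mathrm{PGL}_n(k)$ of representation type $\tau$ is an irreducible unirational variety.
   Context: $\mathrm{Mat}_n(k)$ is the space of $n\times n$ matrices over $k$. $\mathrm{PGL}_n(k)$ acts on $\mathrm{Mat}_n(k)^m$ by simultaneous conjugation, and $/\!\!/$ denotes the categorical quotient (the affine variety whose algebra of regular functions is the algebra of invariants). Points of $\mathrm{Mat}_n(k)^m/\!\!/\mathrm{PGL}_n(k)$ are in bijection with isomorphism classes of $n$-dimensional semisimple representations of the free associative $k$-algebra on $m$ generators. A point corresponding to $V_1^{\oplus e_1}\oplus\cdots\oplus V_r^{\oplus e_r}$ with $V_1,\dots,V_r$ pairwise nonisomorphic simple representations, $\dim V_i=d_i$, has representation type $\tau=\{(d_1,e_1),\dots,(d_r,e_r)\}$ (an unordered collection with repetitions allowed), where $d_i,e_i\geqslant 1$ and $\sum_i d_ie_i=n$. The set $Q_{m,n}(\tau)$ is a locally closed subset of $\mathrm{Mat}_n(k)^m/\!\!/\mathrm{PGL}_n(k)$ and is considered as a variety with the induced structure. An irreducible variety is unirational if it admits a dominant rational map from some affine space. *)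

(* Defs.v *)
From HB Require Import structures.
From mathcomp Require Import all_boot all_order all_algebra.
From mathcomp Require Import boolp.
From mathcomp Require Import mpoly.

Set Implicit Arguments.
Unset Strict Implicit.
Unset Printing Implicit Defensive.

Import GRing.Theory.

Local Open Scope ring_scope.

(* An m-tuple of n x n matrices, that is, an n-dimensional representation of
   the free associative algebra on m generators.  As everywhere in MathComp,
   matrices act on row vectors from the right; transposition exchanges this
   with the action on columns and preserves simplicity, isomorphism and direct
   sums, hence representation types. *)
Definition rep (k : fieldType) (m n : nat) := {ffun 'I_m -> 'M[k]_n}.

Definition rep_conj (k : fieldType) (m n : nat) (g : 'M[k]_n) (x : rep k m n) :
    rep k m n :=
  [ffun a => g *m x a *m invmx g].

(* Unlike the usual isomorphism relation it is stated across dimensions that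
   are not syntactically equal; a row-free and row-full matrix is invertible,
   so d1 = d2 is forced. *)
Definition rep_iso (k : fieldType) (m d1 d2 : nat)
    (x : rep k m d1) (y : rep k m d2) : Prop :=
  exists g : 'M[k]_(d1, d2),
    [/\ row_free g, row_full g & forall a, x a *m g = g *m y a].

Definition rep_simple (k : fieldType) (m d : nat) (x : rep k m d) : Prop :=
  (0 < d)%N /\
  forall U : 'M[k]_d, (forall a, stablemx U (x a)) ->
    \rank U = 0%N \/ \rank U = d.

(* The external direct sum of e i copies of V i, over i < r. *)
Definition rep_sum (k : fieldType) (m r : nat) (d e : 'I_r -> nat)
    (V : forall i : 'I_r, rep k m (d i)) :
    rep k m (\sum_(i < r) \sum_(j < e i) d i)%N :=
  [ffun a => \mxdiag_(i < r) \mxdiag_(j < e i) V i a].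

(* A representation type is the list of the pairs (d_i, e_i).  The order of
   the list is irrelevant, see has_rep_type. *)
Definition is_rep_type (n : nat) (tau : seq (nat * nat)) : bool :=
  all (fun t => (0 < t.1)%N && (0 < t.2)%N) tau &&
  (\sum_(t <- tau) t.1 * t.2 == n)%N.

Definition rt_dim (tau : seq (nat * nat)) (i : 'I_(size tau)) : nat :=
  (nth (0, 0)%N tau i).1.

Definition rt_mult (tau : seq (nat * nat)) (i : 'I_(size tau)) : nat :=
  (nth (0, 0)%N tau i).2.

Definition has_rep_type (k : fieldType) (m n : nat) (tau : seq (nat * nat))
    (x : rep k m n) : Prop :=
  exists V : forall i : 'I_(size tau), rep k m (rt_dim i),
    [/\ forall i, rep_simple (V i),
        forall i j, i != j -> ~ rep_iso (V i) (V j)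
      & rep_iso x (rep_sum (@rt_mult tau) V)].

Definition ncoord (m n : nat) : nat := #|{: 'I_m * 'I_n * 'I_n}|.

Definition coord_of (k : fieldType) (m n : nat) (x : rep k m n)
    (l : 'I_(ncoord m n)) : k :=
  let: (a, i, j) := enum_val l in x a i j.

(* Invariance under all of GL_n(k), which acts through PGL_n(k).  Testing it on
   values is legitimate only over an infinite field. *)
Definition invariant_pred (k : fieldType) (m n : nat) :
    {pred {mpoly k[ncoord m n]}} :=
  fun f => `[< forall (g : 'M[k]_n) (x : rep k m n), g \in unitmx ->
                 f.@[coord_of (rep_conj g x)] = f.@[coord_of x] >].

Fact invariant_subalg (k : fieldType) (m n : nat) :
  subalg_closed (@invariant_pred k m n).
Proof.
split.
- by apply/asboolP => g x _; rewrite !meval1.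
- move=> a u v /asboolP uI /asboolP vI; apply/asboolP => g x gU.
  by rewrite !mevalD !mevalZ uI ?vI.
- move=> u v /asboolP uI /asboolP vI; apply/asboolP => g x gU.
  by rewrite !mevalM uI ?vI.
Qed.

HB.instance Definition _ (k : fieldType) (m n : nat) :=
  GRing.isSubalgClosed.Build k {mpoly k[ncoord m n]} (@invariant_pred k m n)
    (@invariant_subalg k m n).

Record invariant (k : fieldType) (m n : nat) := Invariant {
  invariant_val :> {mpoly k[ncoord m n]};
  _ : invariant_val \in @invariant_pred k m n }.

HB.instance Definition _ (k : fieldType) (m n : nat) :=
  [isSub for @invariant_val k m n].
HB.instance Definition _ (k : fieldType) (m n : nat) :=
  [Choice of invariant k m n by <:].
HB.instance Definition _ (k : fieldType) (m n : nat) :=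
  [SubChoice_isSubAlgebra of invariant k m n by <:].
HB.instance Definition _ (k : fieldType) (m n : nat) :=
  [SubNzRing_isSubComNzRing of invariant k m n by <:].

(* The points of the categorical quotient Mat_n(k)^m // PGL_n(k): the k-points
   of the spectrum of the algebra of invariants. *)
Definition quotient (k : fieldType) (m n : nat) :=
  {lrmorphism invariant k m n -> k^o}.

Definition eval_at (k : fieldType) (m n : nat) (x : rep k m n)
    (f : invariant k m n) : k^o :=
  (invariant_val f).@[coord_of x].

Fact eval_at_linear (k : fieldType) (m n : nat) (x : rep k m n) :
  linear (@eval_at k m n x).
Proof. by move=> a f g; rewrite /eval_at /= mevalD mevalZ. Qed.

Fact eval_at_monoid_morphism (k : fieldType) (m n : nat) (x : rep k m n) :
  monoid_morphism (@eval_at k m n x).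
Proof.
by split=> [|f g]; rewrite /eval_at /= ?meval1 ?mevalM.
Qed.

HB.instance Definition _ (k : fieldType) (m n : nat) (x : rep k m n) :=
  GRing.isLinear.Build k (invariant k m n) k^o *:%R (@eval_at k m n x)
    (@eval_at_linear k m n x).
HB.instance Definition _ (k : fieldType) (m n : nat) (x : rep k m n) :=
  GRing.isMonoidMorphism.Build (invariant k m n) k^o (@eval_at k m n x)
    (@eval_at_monoid_morphism k m n x).

(* The point corresponding to the isomorphism class of x, for x semisimple. *)
Definition quotient_map (k : fieldType) (m n : nat) (x : rep k m n) :
    quotient k m n :=
  @eval_at k m n x.

(* Having a representation type entails that x is semisimple. *)
Definition Q (k : fieldType) (m n : nat) (tau : seq (nat * nat))
    (p : quotient k m n) : Prop :=
  exists x : rep k m n, has_rep_type tau x /\ p =1 quotient_map x.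

Definition quotient_closed (k : fieldType) (m n : nat)
    (Z : quotient k m n -> Prop) : Prop :=
  exists S : invariant k m n -> Prop,
    forall p, Z p <-> (forall f, S f -> p f = 0).

(* Irreducibility in the topology induced from the quotient. *)
Definition irreducible (k : fieldType) (m n : nat)
    (Y : quotient k m n -> Prop) : Prop :=
  (exists p, Y p) /\
  forall Z1 Z2 : quotient k m n -> Prop,
    quotient_closed Z1 -> quotient_closed Z2 ->
    (forall p, Y p -> Z1 p \/ Z2 p) ->
    (forall p, Y p -> Z1 p) \/ (forall p, Y p -> Z2 p).

Definition affine_open (k : fieldType) (N : nat) (U : ('I_N -> k) -> Prop) :
    Prop :=
  exists S : {mpoly k[N]} -> Prop,
    forall v, U v <-> (exists2 f, S f & f.@[v] != 0).

(* Locally on U, h is a quotient of two polynomials. *)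
Definition regular_on (k : fieldType) (N : nat) (U : ('I_N -> k) -> Prop)
    (h : ('I_N -> k) -> k) : Prop :=
  forall u, U u ->
    exists a b : {mpoly k[N]},
      b.@[u] != 0 /\
      forall v, U v -> b.@[v] != 0 -> h v = a.@[v] / b.@[v].

(* The values of phi outside of U are irrelevant.  A morphism from U to the
   affine variety [quotient] is a map that pulls regular functions (invariants)
   back to regular functions; a morphism to the subvariety Y is such a morphism
   with image in Y. *)
Definition morphism_into (k : fieldType) (m n N : nat)
    (U : ('I_N -> k) -> Prop) (Y : quotient k m n -> Prop)
    (phi : ('I_N -> k) -> quotient k m n) : Prop :=
  (forall u, U u -> Y (phi u)) /\
  (forall f : invariant k m n, regular_on U (fun u => phi u f)).

Definition dominant (k : fieldType) (m n N : nat)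
    (U : ('I_N -> k) -> Prop) (Y : quotient k m n -> Prop)
    (phi : ('I_N -> k) -> quotient k m n) : Prop :=
  forall Z : quotient k m n -> Prop, quotient_closed Z ->
    (forall u, U u -> Z (phi u)) -> forall p, Y p -> Z p.

(* A dominant rational map from affine N-space to Y, given on a nonempty open
   domain of definition U. *)
Definition unirational (k : fieldType) (m n : nat)
    (Y : quotient k m n -> Prop) : Prop :=
  exists (N : nat) (U : ('I_N -> k) -> Prop)
         (phi : ('I_N -> k) -> quotient k m n),
    [/\ affine_open U, exists u, U u, morphism_into U Y phi
      & dominant U Y phi].

(* Main.v *)
(* The representation type stratum is the image of the affine space of all
   families (V_i) under (V_i) |-> sum of the V_i^(e_i): every point of the
   stratum comes from such a family, and conversely a generic family consists
   of pairwise nonisomorphic simple representations.  Hence invariants pull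
   back to polynomials, the stratum inherits irreducibility from the affine
   space, and the parametrization restricted to a principal open set is
   dominant.  Genericity needs only a sufficient polynomial condition: V_i is
   simple when the words A^p B A^q in its first two matrices A and B span all
   matrices, which a Vandermonde determinant achieves for A diagonal with
   distinct entries and B filled with ones; V_i and V_j are nonisomorphic when
   their first matrices have distinct traces. *)
Require Import Defs.
From mathcomp Require Import all_boot all_order all_algebra.
From mathcomp Require Import boolp mpoly.

Set Implicit Arguments.
Unset Strict Implicit.
Unset Printing Implicit Defensive.

Import GRing.Theory.

Local Open Scope ring_scope.

(** * Zariski-generic properties of points of affine space *)

Definition generically (k : fieldType) (N : nat) (P : ('I_N -> k) -> Prop) :
    Prop :=
  exists g : {mpoly k[N]},
    (exists u, g.@[u] != 0) /\ forall u, g.@[u] != 0 -> P u.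

Section Generically.

Variables (k : closedFieldType) (N : nat).
Implicit Types (P Q : ('I_N -> k) -> Prop) (f g : {mpoly k[N]}).

(** The restriction of [g] to the line with [u] at parameter 0 and [v] at parameter 1. *)
Definition mpoly_line (u v : 'I_N -> k) g : {poly k} :=
  mmap polyC (fun i => (u i)%:P + (v i - u i) *: 'X) g.

Lemma horner_mpoly_line u v g t :
  (mpoly_line u v g).[t] = g.@[fun i => u i + (v i - u i) * t].
Proof.
rewrite /mpoly_line /meval /mmap horner_sum; apply: eq_bigr => x _.
rewrite hornerM hornerC /mmap1 horner_prod; congr (_ * _).
by apply: eq_bigr => i _; rewrite horner_exp !hornerE.
Qed.

(** On the line joining [u] and [v] both restrictions are nonzero univariate polynomials, and their
    product has a nonroot because an algebraically closed field is infinite. *)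
Lemma mpoly_common_nonroot f g :
    (exists u, f.@[u] != 0) -> (exists v, g.@[v] != 0) ->
  exists w, f.@[w] * g.@[w] != 0.
Proof.
move=> [u fu] [v gv].
have line0 : mpoly_line u v f != 0.
  apply: contraNneq fu => /(congr1 (horner^~ 0)).
  rewrite horner_mpoly_line horner0 => <-; apply/eqP/meval_eq => i.
  by rewrite mulr0 addr0.
have line1 : mpoly_line u v g != 0.
  apply: contraNneq gv => /(congr1 (horner^~ 1)).
  rewrite horner_mpoly_line horner0 => <-; apply/eqP/meval_eq => i.
  by rewrite mulr1 addrC subrK.
have /closed_nonrootP[t] := mulf_neq0 line0 line1.
rewrite /root hornerM !horner_mpoly_line => nz.
by exists (fun i => u i + (v i - u i) * t).
Qed.

Lemma generically_and P Q :
  generically P -> generically Q -> generically (fun u => P u /\ Q u).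
Proof.
move=> [f [f0 fP]] [g [g0 gQ]]; exists (f * g); split.
  by have [w] := mpoly_common_nonroot f0 g0; exists w; rewrite mevalM.
by move=> u; rewrite mevalM mulf_eq0 negb_or => /andP[/fP Pu /gQ Qu].
Qed.

Lemma generically_forall (I : finType) (P : I -> ('I_N -> k) -> Prop) :
  (forall i, generically (P i)) -> generically (fun u => forall i, P i u).
Proof.
move=> genP.
have [g [g0 gP]] : generically (fun u => forall i, i \in enum I -> P i u).
  elim: (enum I) => [|i s IHs].
    by exists 1; split=> //; exists (fun=> 0); rewrite meval1 oner_neq0.
  have [g [g0 gP]] := generically_and (genP i) IHs.
  exists g; split=> // u /gP[Piu Psu] j.
  by rewrite inE => /predU1P[-> // | /Psu].
by exists g; split=> // u /gP gPu i; apply: gPu; rewrite mem_enum.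
Qed.

Lemma generically_ex P : generically P -> exists u, P u.
Proof. by move=> [g [[u gu] gP]]; exists u; apply: gP. Qed.

Lemma generically_neq0 f u : f.@[u] != 0 -> generically (fun v => f.@[v] != 0).
Proof. by move=> fu; exists f; split=> //; exists u. Qed.

End Generically.

(** * Subsets of the quotient parametrized polynomially by affine space *)

Section Parametrization.

Variables (k : closedFieldType) (m n N : nat).
Variables (Y : quotient k m n -> Prop) (phi : ('I_N -> k) -> quotient k m n).
Hypothesis phi_poly :
  forall f, exists F : {mpoly k[N]}, forall u, phi u f = F.@[u].
Hypothesis phi_onto : forall p, Y p -> exists u, p =1 phi u.
Hypothesis phi_in : generically (fun u => Y (phi u)).

Lemma generically_param_neq0 p f :
  Y p -> p f != 0 -> generically (fun u => phi u f != 0).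
Proof.
move=> /phi_onto[u pE]; have [F FE] := phi_poly f.
rewrite pE FE => /generically_neq0[g [g0 gF]].
by exists g; split=> // v /gF; rewrite FE.
Qed.

(** Some equation of [Z] fails at a point of [Y]; that point has the form [phi u], so the equation
    pulls back to a nonzero polynomial. *)
Lemma not_sub_quotient_closed (Z : quotient k m n -> Prop)
    (S : Defs.invariant k m n -> Prop) :
    (forall p, Z p <-> (forall f, S f -> p f = 0)) ->
    ~ (forall p, Y p -> Z p) ->
  generically (fun u => ~ Z (phi u)).
Proof.
move=> ZE /existsNP[p /not_implyP[Yp]].
rewrite ZE => /existsNP[f /not_implyP[Sf /eqP pf]].
have [g [g0 gf]] := generically_param_neq0 Yp pf.
by exists g; split=> // u /gf /eqP fu; rewrite ZE => /(_ _ Sf).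
Qed.

(** If neither closed set contained [Y], a generic [phi u] would lie in [Y] and outside both. *)
Lemma irreducible_param : irreducible Y.
Proof.
split; first by have [u Yu] := generically_ex phi_in; exists (phi u).
move=> Z1 Z2 [S1 Z1E] [S2 Z2E] YZ; apply: contrapT => /not_orP[nYZ1 nYZ2].
have := generically_and (not_sub_quotient_closed Z1E nYZ1)
                        (not_sub_quotient_closed Z2E nYZ2).
by move=> /(generically_and phi_in)/generically_ex[u [/YZ[]] ? []].
Qed.

(** The map [phi] is polynomial everywhere; it is restricted to a principal open set only to make it
    land in [Y]. *)
Lemma unirational_param : unirational Y.
Proof.
have [g [g0 gY]] := phi_in.
exists N, (fun u => g.@[u] != 0), phi; split=> //.
- by exists (eq g) => v; split=> [gv | [_ <-]] //; exists g.
- split=> // f u gu; have [F FE] := phi_poly f.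
  by exists F, 1; split=> [|v _ _]; rewrite meval1 ?oner_neq0 // divr1.
- move=> Z [S ZE] gZ; apply: contrapT => /(not_sub_quotient_closed ZE) nZ.
  have gen_g : generically (fun u => g.@[u] != 0) by exists g.
  by have [u [/gZ ?]] := generically_ex (generically_and gen_g nZ).
Qed.

End Parametrization.

(** * A determinantal criterion for simplicity *)

Section Words.

Variable d : nat.

(** Invertible over a field exactly when the words [A ^+ p *m B *m A ^+ q] form a basis of the
    matrix space. The size [d.+1] gives square matrices the ring structure needed for powers. *)
Definition words_mx (R : pzRingType) (A B : 'M[R]_d.+1) :
    'M[R]_(d.+1 * d.+1) :=
  \matrix_r mxvec (let: (p, q) := enum_val (cast_ord (esym (mxvec_cast _ _)) r)
                   in A ^+ p *m B *m A ^+ q).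

Lemma row_words_mx (R : pzRingType) (A B : 'M[R]_d.+1) p q :
  row (mxvec_index p q) (words_mx A B) = mxvec (A ^+ p *m B *m A ^+ q).
Proof. by rewrite rowK /mxvec_index cast_ordK enum_rankK. Qed.

Lemma map_words_mx (R S : pzRingType) (f : {rmorphism R -> S})
    (A B : 'M[R]_d.+1) :
  map_mx f (words_mx A B) = words_mx (map_mx f A) (map_mx f B).
Proof.
apply/row_matrixP => r; case/mxvec_indexP: r => p q.
by rewrite -map_row !row_words_mx map_mxvec !map_mxM !rmorphXn.
Qed.

Lemma mxvec_mul_words_mx (R : comPzRingType) (A B C : 'M[R]_d.+1) :
  mxvec C *m words_mx A B
  = \sum_p \sum_q C p q *: mxvec (A ^+ p *m B *m A ^+ q).
Proof.
rewrite mulmx_sum_row pair_big /=.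
rewrite (reindex (uncurry (@mxvec_index d.+1 d.+1))) /=; last first.
  exact: curry_mxvec_bij.
by apply: eq_bigr => -[p q] _ /=; rewrite mxvecE row_words_mx.
Qed.

(** Invertibility writes [M] as a linear combination of words, each of which preserves [U]. *)
Lemma stablemx_words (k : fieldType) (A B U M : 'M[k]_d.+1) :
    words_mx A B \in unitmx -> stablemx U A -> stablemx U B ->
  stablemx U M.
Proof.
move=> Wunit UA UB.
have UX p : stablemx U (A ^+ p).
  elim: p => [|p IHp]; first by rewrite expr0 mulmx1.
  by rewrite exprS stablemxM.
have ->: M = vec_mx (mxvec (vec_mx (mxvec M *m invmx (words_mx A B)))
                     *m words_mx A B).
  by rewrite vec_mxK mulmxKV // mxvecK.
rewrite mxvec_mul_words_mx linear_sum mulmx_sumr summx_sub // => p _.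
rewrite linear_sum mulmx_sumr summx_sub // => q _.
rewrite linearZ /= mxvecK -scalemxAr scalemx_sub //.
by apply: stablemxM; rewrite ?stablemxM.
Qed.

(** If [U s t] is nonzero, row [s] of [U *m delta_mx t j] is [U s t] times the [j]-th basis row, so
    every basis row lies in the row space of [U]. *)
Lemma full_stablemx (k : fieldType) (U : 'M[k]_d) :
  (forall M, stablemx U M) -> \rank U = 0%N \/ \rank U = d.
Proof.
move=> Ustable; have [->|/matrix0Pn[s [t Ust]]] := eqVneq U 0.
  by left; rewrite mxrank0.
right; apply/eqP/row_fullP; apply/row_fullP; rewrite -sub1mx.
apply/row_subP => j; rewrite row1.
have -> : delta_mx 0 j = (U s t)^-1 *: row s (U *m delta_mx t j).
  apply/rowP => l; rewrite !mxE (bigD1 t) //= big1 => [|i /negPf it].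
    by rewrite addr0 mxE !eqxx /= mulrA mulVf // mul1r.
  by rewrite mxE it mulr0.
by rewrite scalemx_sub // (submx_trans (row_sub _ _)) // Ustable.
Qed.

Lemma exp_diag_mx (R : pzRingType) (a : 'rV[R]_d.+1) p :
  diag_mx a ^+ p = diag_mx (\row_j a 0 j ^+ p).
Proof.
elim: p => [|p IHp].
  by rewrite expr0; apply/matrixP => i j; rewrite !mxE expr0.
rewrite exprS IHp [LHS]mulmx_diag; congr diag_mx.
by apply/rowP => j; rewrite !mxE exprS.
Qed.

(** Entry [(s, t)] of the word with exponents [p], [q] is [a 0 s ^+ p * a 0 t ^+ q], so the
    combination with coefficients [C] is [V^T *m C *m V] for the Vandermonde matrix [V]. As [V] is
    invertible, every matrix arises in this way. *)
Lemma unitmx_words_diag (k : fieldType) (a : 'rV[k]_d.+1) :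
    (forall i j : 'I_d.+1, (i < j)%N -> a 0 i != a 0 j) ->
  words_mx (diag_mx a) (const_mx 1) \in unitmx.
Proof.
move=> a_neq.
pose V : 'M[k]_d.+1 := Vandermonde d.+1 a.
have Vunit : V \in unitmx.
  rewrite unitmxE unitfE det_Vandermonde.
  apply/prodf_neq0 => i _; apply/prodf_neq0 => j ij.
  by rewrite subr_eq0 eq_sym a_neq.
rewrite -row_full_unit -sub1mx; apply/row_subP => r.
rewrite -[row r _]vec_mxK; set M := vec_mx _.
have [C ->] : exists C, M = V^T *m C *m V.
  exists (invmx V^T *m M *m invmx V).
  by rewrite !mulmxA mulmxV ?unitmx_tr // mul1mx -mulmxA mulVmx // mulmx1.
suff -> : V^T *m C *m V
    = \sum_p \sum_q C p q *: (diag_mx a ^+ p *m const_mx 1 *m diag_mx a ^+ q).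
  rewrite linear_sum /=.
  under eq_bigr do (rewrite linear_sum /=; under eq_bigr do rewrite linearZ /=).
  by rewrite -mxvec_mul_words_mx submxMl.
apply/matrixP => s t; rewrite mxE summxE.
under eq_bigr do rewrite mxE big_distrl /=.
rewrite exchange_big /=; apply: eq_bigr => p _; rewrite summxE.
apply: eq_bigr => q _; rewrite !exp_diag_mx mxE mul_mx_diag mxE mul_diag_mx.
by rewrite !mxE mulr1 mulrA [C p q * _]mulrC.
Qed.

End Words.

Lemma generically_simple (k : closedFieldType) (N m d : nat)
    (X : 'I_m -> 'M[{mpoly k[N]}]_d) (a0 a1 : 'I_m) :
    [pchar k]%R =i pred0 -> (0 < d)%N ->
    (forall A B : 'M[k]_d, exists u,
       map_mx (meval u) (X a0) = A /\ map_mx (meval u) (X a1) = B) ->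
  generically (fun u =>
    rep_simple ([ffun a => map_mx (meval u) (X a)] : rep k m d)).
Proof.
case: d X => // d X /pcharf0P char0 _ Xonto.
have detE u : (\det (words_mx (X a0) (X a1))).@[u]
    = \det (words_mx (map_mx (meval u) (X a0)) (map_mx (meval u) (X a1))).
  by rewrite -det_map_mx map_words_mx.
exists (\det (words_mx (X a0) (X a1))); split.
  (* The diagonal entries 0, ..., [d] are distinct because the characteristic is 0. *)
  have [u [uA uB]] := Xonto (diag_mx (\row_j (j : nat)%:R)) (const_mx 1).
  exists u; rewrite detE uA uB -unitfE -unitmxE unitmx_words_diag // => i j ij.
  rewrite !mxE eq_sym -subr_eq0 -natrB ?(ltnW ij) // char0.
  by rewrite -lt0n subn_gt0.
move=> u; rewrite detE -unitfE -unitmxE => Wunit; split=> // U Ustable.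
apply: full_stablemx => M; apply: stablemx_words Wunit _ _.
  by have := Ustable a0; rewrite ffunE.
by have := Ustable a1; rewrite ffunE.
Qed.

(** * Invariants of isomorphic representations *)

Section Isomorphism.

Variables (k : fieldType) (m : nat).

Lemma rep_iso_refl d (x : rep k m d) : rep_iso x x.
Proof.
exists 1%:M; split=> [||a]; rewrite ?row_free_unit ?row_full_unit ?unitmx1 //.
by rewrite mulmx1 mul1mx.
Qed.

Lemma rep_iso_trace d1 d2 (x : rep k m d1) (y : rep k m d2) a :
  rep_iso x y -> \tr (x a) = \tr (y a).
Proof.
move=> [g [/row_freeP[h gh] /row_fullP[h' h'g] xg]].
(* The right inverse [h] and the left inverse [h'] of [g] coincide, although [g] is not
   syntactically square. *)
have hg : h *m g = 1%:M.
  by rewrite -[h]mul1mx -h'g -(mulmxA h') gh mulmx1.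
by rewrite -[x a]mulmx1 -gh mulmxA xg -mulmxA mxtrace_mulC -mulmxA hg mulmx1.
Qed.

Lemma rep_iso_quotient_map n (x y : rep k m n) :
  rep_iso x y -> quotient_map x =1 quotient_map y.
Proof.
move=> [g [+ _ xg]]; rewrite row_free_unit => gU f.
have -> : x = rep_conj g y.
  by apply/ffunP => a; rewrite ffunE -xg mulmxK.
case: f => f finv; rewrite /quotient_map /= /eval_at /=.
by move/asboolP: (finv); apply.
Qed.

End Isomorphism.

(** * The affine space of families and their direct sums *)

Section DirectSums.

Variables (k : closedFieldType) (m r : nat) (d e : 'I_r -> nat).

Definition family_index := {i : 'I_r & 'I_m * 'I_(d i) * 'I_(d i)}%type.

Let N := #|{: family_index}|.

(** Generic matrices: the entries are distinct indeterminates, one for each coordinate of a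
    family. *)
Definition family_var (i : 'I_r) (a : 'I_m) : 'M[{mpoly k[N]}]_(d i) :=
  \matrix_(s, t)
    'X_(enum_rank (Tagged (fun i => 'I_m * 'I_(d i) * 'I_(d i))%type
                          (a, s, t))).

Definition family (u : 'I_N -> k) (i : 'I_r) : rep k m (d i) :=
  [ffun a => map_mx (meval u) (family_var i a)].

Lemma family_onto (V : forall i, rep k m (d i)) :
  exists u, forall i, family u i = V i.
Proof.
exists (fun l => let: existT i (a, s, t) := enum_val l in V i a s t) => i.
apply/ffunP => a; apply/matrixP => s t.
by rewrite ffunE !mxE mevalXU enum_rankK.
Qed.

Lemma rep_sum_poly :
  exists X : 'I_m -> 'M[{mpoly k[N]}]_(\sum_(i < r) \sum_(j < e i) d i),
    forall u a, rep_sum e (family u) a = map_mx (meval u) (X a).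
Proof.
exists (fun a => \mxdiag_(i < r) \mxdiag_(j < e i) family_var i a) => u a.
have map_mxdiag p (q : 'I_p -> nat) (B : forall i, 'M[{mpoly k[N]}]_(q i)) :
    map_mx (meval u) (\mxdiag_i B i) = \mxdiag_i map_mx (meval u) (B i).
  apply/matrixP => s t; rewrite !mxE; case: ifP => _.
    by rewrite -(raddf0 (map_mx (meval u))) -map_conform_mx mxE.
  by rewrite !mxE raddf0.
rewrite ffunE map_mxdiag; apply: eq_mxdiag => i.
by rewrite map_mxdiag; apply: eq_mxdiag => j; rewrite ffunE.
Qed.

Lemma quotient_map_rep_sum_poly f :
  exists F : {mpoly k[N]},
    forall u, quotient_map (rep_sum e (family u)) f = F.@[u].
Proof.
have [X XE] := rep_sum_poly.
pose lq := [tuple (let: (a, i, j) := enum_val l in X a i j)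
           | l < ncoord m (\sum_(i < r) \sum_(j < e i) d i)].
exists (invariant_val f \mPo lq) => u; rewrite comp_mpoly_meval.
rewrite /quotient_map /= /eval_at; apply: meval_eq => l.
by rewrite tnth_mktuple /coord_of; case: enum_val => [[a i] j]; rewrite XE mxE.
Qed.

Hypothesis d_gt0 : forall i, (0 < d i)%N.

Lemma generically_simple_family :
    [pchar k]%R =i pred0 -> (1 < m)%N ->
  generically (fun u => forall i, rep_simple (family u i)).
Proof.
move=> char0 m_gt1; apply: generically_forall => i.
pose a0 := Ordinal (ltnW m_gt1); pose a1 := Ordinal m_gt1.
apply: (@generically_simple _ _ _ _ _ a0 a1) => // A B.
(* Here [A] and [B] have the size of the fixed member; [conform_mx] puts 0 in members of any other
   size, whose values do not matter. *)
pose V i : rep k m (d i) :=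
  [ffun a => conform_mx 0 (if a == a0 then A else B)].
have [u uV] := family_onto V; exists u.
have famE a : map_mx (meval u) (family_var i a) = V i a.
  by rewrite -uV ffunE.
by rewrite !famE !ffunE !conform_mx_id.
Qed.

Lemma generically_noniso_family :
    (0 < m)%N ->
  generically (fun u => forall i j, i != j ->
    ~ rep_iso (family u i) (family u j)).
Proof.
move=> m_gt0; apply: generically_forall => i; apply: generically_forall => j.
have [->|ij] := eqVneq i j.
  by exists 1; split=> //; exists (fun=> 0); rewrite meval1 oner_neq0.
pose a0 := Ordinal m_gt0.
pose g := \tr (family_var i a0) - \tr (family_var j a0).
have gE u : g.@[u] = \tr (family u i a0) - \tr (family u j a0).
  by rewrite mevalB !ffunE !trace_map_mx.
exists g; split; last first.
  move=> u; rewrite gE subr_eq0 => /eqP tr_neq _.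
  by move=> /(rep_iso_trace a0).
(* A matrix unit at [i] and 0 at [j] have traces 1 and 0, so [g] is not identically zero. *)
pose s0 l : 'I_(d l) := Ordinal (d_gt0 l).
pose V l : rep k m (d l) :=
  [ffun=> if l == i then delta_mx (s0 l) (s0 l) else 0].
have [u uV] := family_onto V; exists u.
rewrite gE !uV !ffunE eqxx (eq_sym j) (negPf ij) mxtrace0 subr0.
rewrite /mxtrace (bigD1 (s0 i)) //= big1 => [|s /negPf s_neq].
  by rewrite mxE !eqxx addr0 oner_neq0.
by rewrite mxE s_neq.
Qed.

End DirectSums.

Local Close Scope ring_scope.

Theorem corollary5 (k : closedFieldType) (m n : nat) (tau : seq (nat * nat)) :
  [pchar k]%R =i pred0 -> 3 <= m -> 1 <= n -> is_rep_type n tau ->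
  irreducible (@Q k m n tau) /\ unirational (@Q k m n tau).
Proof.
move=> char0 m_ge3 _ /andP[/all_nthP tau_gt0 /eqP tau_n].
have d_gt0 (i : 'I_(size tau)) : (0 < rt_dim i)%N.
  by have /andP[] := tau_gt0 (0, 0)%N i (ltn_ord i).
have {tau_gt0 tau_n} nE :
    (\sum_(i < size tau) \sum_(j < rt_mult i) rt_dim i)%N = n.
  rewrite -tau_n (big_nth (0, 0)%N) big_mkord; apply: eq_bigr => i _.
  by rewrite sum_nat_const card_ord mulnC.
(* With [n] replaced by the dimension of the direct sum, [phi] takes values in the right quotient
   without casts. *)
subst n.
pose phi u := quotient_map (rep_sum (@rt_mult tau)
                              (@family k m _ (@rt_dim tau) u)).
have phi_poly := @quotient_map_rep_sum_poly k m _ (@rt_dim tau) (@rt_mult tau).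
have phi_onto p : Q tau p -> exists u, p =1 phi u.
  move=> [x [[V [_ _ /rep_iso_quotient_map xV]] px]].
  have [u uV] := family_onto V; exists u => f.
  (* The pointwise equality [uV] must become an equality of dependent families before it can be
     rewritten inside [rep_sum]. *)
  by rewrite px xV /phi (functional_extensionality_dep uV).
have phi_in : generically (fun u => Q tau (phi u)).
  have m_gt1 : (1 < m)%N by apply: ltnW.
  have [g [g0 gP]] := generically_and
    (@generically_simple_family k m _ _ d_gt0 char0 m_gt1)
    (@generically_noniso_family k m _ _ d_gt0 (ltnW m_gt1)).
  exists g; split=> // u /gP[simpleV nonisoV].
  exists (rep_sum (@rt_mult tau) (family u)); split=> //.
  by exists (family u); split=> //; apply: rep_iso_refl.
by split; [exact: irreducible_param phi_poly phi_onto phi_in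
          | exact: unirational_param phi_poly phi_onto phi_in].
Qed.
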